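(* Let $G$ be a finite group, let $(\mathcal{O}_m,\mathcal{O}_a)$ be a pair of indexing categories for $G$, and let $(\mathcal{T}_m,\mathcal{T}_a)$ be the corresponding pair of transfer systems. Then $(\mathcal{O}_m,\mathcal{O}_a)$ is a compatible pair of indexing categories if and only if $(\mathcal{T}_m,\mathcal{T}_a)$ is a compatible pair of transfer systems.
   Context: $\mathrm{Set}^G$ is the category of finite $G$-sets; $H^g=gHg^{-1}$. An indexing category for $G$ is a wide subcategory $\mathcal{O}\subset\mathrm{Set}^G$ that is pullback stable (the base change in $\mathrm{Set}^G$ of a morphism of $\mathcal{O}$ along any map is in $\mathcal{O}$) and finite coproduct complete (it has finite coproducts, computed as in $\mathrm{Set}^G$). For a map $n\colon S\to T$ in $\mathrm{Set}^G$, $n_*\colon\mathrm{Set}^G_{/S}\to\mathrm{Set}^G_{/T}$ is the right adjoint of the pullback functor $n^*$ (the dependent product). A pair of indexing categories $(\mathcal{O}_m,\mathcal{O}_a)$ is compatible if for all $n\colon S\to T$ in $\mathcal{O}_m$ one has $n_*((\mathcal{O}_a)_{/S})\subset(\mathcal{O}_a)_{/T}$, i.e. $n_*$ sends maps to $S$ in $\mathcal{O}_a$ to maps to $T$ in $\mathcal{O}_a$. A $G$-transfer system $\mathcal{T}$ is a partial order $\leq_{\mathcal{T}}$ on the set of subgroups of $G$ such that: (1) $K\leq_{\mathcal{T}}H$ implies $K\le H$; (2) $K\leq_{\mathcal{T}}H$ implies $K^g\leq_{\mathcal{T}}H^g$ for all $g\in G$; (3) $K\leq_{\mathcal{T}}H$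 implies $(K\cap L)\leq_{\mathcal{T}}(H\cap L)$ for all $L\le G$. The transfer system corresponding to an indexing category $\mathcal{O}$ is: $K\leq_{\mathcal{T}}H$ iff $K\le H$ and the canonical quotient $G/K\to G/H$ is in $\mathcal{O}$ (this gives an isomorphism between the posets of indexing categories and transfer systems). Write $\mathcal{T}_1\le\mathcal{T}_2$ if $K\leq_{\mathcal{T}_1}H$ implies $K\leq_{\mathcal{T}_2}H$. A pair $(\mathcal{T}_1,\mathcal{T}_2)$ of $G$-transfer systems is compatible if (1) $\mathcal{T}_1\le\mathcal{T}_2$, and (2) whenever $A\le G$ and $B,C\le A$ are subgroups such that $B\leq_{\mathcal{T}_1}A$ and $(B\cap C)\leq_{\mathcal{T}_2}B$, then $C\leq_{\mathcal{T}_2}A$. *)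

(* Defs.v *)
From HB Require Import structures.
From mathcomp Require Import all_boot all_fingroup.

Set Implicit Arguments.
Unset Strict Implicit.
Unset Printing Implicit Defensive.

Import GroupScope.

(* MathComp actions are right actions: a left G-set is encoded by the right
   action of the inverse, that is, [gact x a] stands for a^-1 . x. *)
Record gset (gT : finGroupType) := GSet {
  gset_sort :> finType;
  gset_act : {action gT &-> gset_sort} }.

Definition gact (gT : finGroupType) (X : gset gT) (x : X) (a : gT) : X :=
  gset_act X x a.

Definition equivariant (gT : finGroupType) (X Y : gset gT)
    (f : {ffun X -> Y}) : bool :=
  [forall x, forall a, f (gact x a) == gact (f x) a].

Record gmap (gT : finGroupType) (X Y : gset gT) := GMap {
  gmap_fun :> {ffun X -> Y};
  gmap_equivariant : equivariant gmap_fun }.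

HB.instance Definition _ (gT : finGroupType) (X Y : gset gT) :=
  [isSub for @gmap_fun gT X Y].
HB.instance Definition _ (gT : finGroupType) (X Y : gset gT) :=
  [Equality of gmap X Y by <:].

Lemma gmapJ (gT : finGroupType) (X Y : gset gT) (f : gmap X Y) x a :
  f (gact x a) = gact (f x) a.
Proof. by case: f => f /= /forallP/(_ x)/forallP/(_ a)/eqP. Qed.

Lemma gmapP (gT : finGroupType) (X Y : gset gT) (f g : gmap X Y) :
  f =1 g -> f = g.
Proof. by move=> fg; apply/val_inj/ffunP. Qed.

Lemma mk_gmap_subproof (gT : finGroupType) (X Y : gset gT) (f : X -> Y) :
  (forall x a, f (gact x a) = gact (f x) a) -> equivariant (finfun f).
Proof. by move=> fJ; apply/forallP=> x; apply/forallP=> a; rewrite !ffunE fJ. Qed.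

Definition mk_gmap (gT : finGroupType) (X Y : gset gT) (f : X -> Y)
    (fJ : forall x a, f (gact x a) = gact (f x) a) : gmap X Y :=
  GMap (mk_gmap_subproof fJ).

Lemma mk_gmapE (gT : finGroupType) (X Y : gset gT) (f : X -> Y) fJ x :
  @mk_gmap gT X Y f fJ x = f x.
Proof. by rewrite /= ffunE. Qed.

Definition gid (gT : finGroupType) (X : gset gT) : gmap X X :=
  @mk_gmap gT X X id (fun x a => erefl).

Lemma gcomp_subproof (gT : finGroupType) (X Y Z : gset gT)
    (g : gmap Y Z) (f : gmap X Y) x a :
  g (f (gact x a)) = gact (g (f x)) a.
Proof. by rewrite !gmapJ. Qed.

Definition gcomp (gT : finGroupType) (X Y Z : gset gT)
    (g : gmap Y Z) (f : gmap X Y) : gmap X Z :=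
  mk_gmap (gcomp_subproof g f).

Lemma gidE (gT : finGroupType) (X : gset gT) x : gid X x = x.
Proof. exact: mk_gmapE. Qed.

Lemma gcompE (gT : finGroupType) (X Y Z : gset gT)
    (g : gmap Y Z) (f : gmap X Y) x : gcomp g f x = g (f x).
Proof. exact: mk_gmapE. Qed.

Definition mk_gset (gT : finGroupType) (X : finType) (to : X -> gT -> X)
    (to1 : forall x, to x 1 = x)
    (toM : forall x a b, to x (a * b) = to (to x a) b) : gset gT :=
  GSet (TotalAction (to1 : to^~ 1 =1 id) toM).

Lemma sub_gset1 (gT : finGroupType) (X : gset gT) (P : pred X)
    (PJ : forall x a, P x -> P (gact x a)) (u : {x | P x}) :
  exist _ (gact (val u) 1) (PJ _ 1 (valP u)) = u.
Proof. by apply: val_inj; rewrite /= /gact act1. Qed.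

Lemma sub_gsetM (gT : finGroupType) (X : gset gT) (P : pred X)
    (PJ : forall x a, P x -> P (gact x a)) (u : {x | P x}) a b
    (to := fun (v : {x | P x}) c =>
             exist P (gact (val v) c) (PJ _ c (valP v))) :
  to u (a * b) = to (to u a) b.
Proof. by apply: val_inj; rewrite /= /gact actM. Qed.

Definition sub_gset (gT : finGroupType) (X : gset gT) (P : pred X)
    (PJ : forall x a, P x -> P (gact x a)) : gset gT :=
  @mk_gset gT {x | P x}
    (fun u a => exist P (gact (val u) a) (PJ _ a (valP u)))
    (sub_gset1 PJ) (sub_gsetM PJ).

Lemma prod_gset1 (gT : finGroupType) (X Y : gset gT) (u : X * Y) :
  (gact u.1 1, gact u.2 1) = u.
Proof. by case: u => x y; rewrite /gact !act1. Qed.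

Lemma prod_gsetM (gT : finGroupType) (X Y : gset gT) (u : X * Y) a b :
  (gact u.1 (a * b), gact u.2 (a * b))
  = (gact (gact u.1 a) b, gact (gact u.2 a) b).
Proof. by rewrite /gact !actM. Qed.

Definition prod_gset (gT : finGroupType) (X Y : gset gT) : gset gT :=
  @mk_gset gT (X * Y)%type (fun u a => (gact u.1 a, gact u.2 a))
    (@prod_gset1 gT X Y) (@prod_gsetM gT X Y).

Definition is_pullback (gT : finGroupType) (P S X T : gset gT)
    (f : gmap S T) (g : gmap X T) (p1 : gmap P S) (p2 : gmap P X) : Prop :=
  gcomp f p1 = gcomp g p2 /\
  forall (Z : gset gT) (u : gmap Z S) (v : gmap Z X),
    gcomp f u = gcomp g v ->
    exists! w : gmap Z P, gcomp p1 w = u /\ gcomp p2 w = v.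

Definition morphism_class (gT : finGroupType) : Type :=
  forall X Y : gset gT, gmap X Y -> Prop.

Definition all_gmaps (gT : finGroupType) : morphism_class gT :=
  fun _ _ _ => True.

(* [W] is meant to be a wide subcategory: the cocone [inj] lies in [W] and is
   universal among the cocones lying in [W]. *)
Definition is_coproduct_in (gT : finGroupType) (W : morphism_class gT)
    (I : finType) (X : I -> gset gT) (P : gset gT)
    (inj : forall i, gmap (X i) P) : Prop :=
  (forall i, W _ _ (inj i)) /\
  forall (Y : gset gT) (f : forall i, gmap (X i) Y),
    (forall i, W _ _ (f i)) ->
    exists! h : gmap P Y, W _ _ h /\ forall i, gcomp h (inj i) = f i.

(* Being wide, the subcategory is given by its morphisms.  Since finite G-sets
   have all finite coproducts, [ic_coproduct] both gives the existence of
   finite coproducts in the subcategory and computes them as in G-sets; the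
   case of an empty [I] is the initial object. *)
Record indexing_category (gT : finGroupType) := IndexingCategory {
  ic_mor :> forall X Y : gset gT, gmap X Y -> Prop;
  ic_id : forall X : gset gT, ic_mor (gid X);
  ic_comp : forall (X Y Z : gset gT) (g : gmap Y Z) (f : gmap X Y),
    ic_mor g -> ic_mor f -> ic_mor (gcomp g f);
  ic_pullback : forall (P S X T : gset gT) (f : gmap S T) (g : gmap X T)
    (p1 : gmap P S) (p2 : gmap P X),
    is_pullback f g p1 p2 -> ic_mor f -> ic_mor p2;
  ic_coproduct : forall (I : finType) (X : I -> gset gT) (P : gset gT)
    (inj : forall i, gmap (X i) P),
    is_coproduct_in (@all_gmaps gT) inj -> is_coproduct_in ic_mor inj }.

Record over (gT : finGroupType) (T : gset gT) := Over {
  over_dom : gset gT;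
  over_map : gmap over_dom T }.

Record over_hom (gT : finGroupType) (T : gset gT) (X Y : over T) := OverHom {
  oh_map :> gmap (over_dom X) (over_dom Y);
  oh_comm : gcomp (over_map Y) oh_map == over_map X }.

HB.instance Definition _ (gT : finGroupType) (T : gset gT) (X Y : over T) :=
  [isSub for @oh_map gT T X Y].
HB.instance Definition _ (gT : finGroupType) (T : gset gT) (X Y : over T) :=
  [Equality of over_hom X Y by <:].

Lemma oh_mapE (gT : finGroupType) (T : gset gT) (X Y : over T)
    (k : over_hom X Y) x : over_map Y (k x) = over_map X x.
Proof. by have/eqP <- := oh_comm k; rewrite gcompE. Qed.

Lemma oh_comp_subproof (gT : finGroupType) (T : gset gT) (X Y Z : over T)
    (l : over_hom Y Z) (k : over_hom X Y) :
  gcomp (over_map Z) (gcomp l k) == over_map X.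
Proof. by apply/eqP/gmapP=> x; rewrite !gcompE !oh_mapE. Qed.

Definition oh_comp (gT : finGroupType) (T : gset gT) (X Y Z : over T)
    (l : over_hom Y Z) (k : over_hom X Y) : over_hom X Z :=
  OverHom (oh_comp_subproof l k).

Lemma fprod_subproof (gT : finGroupType) (S X T : gset gT)
    (f : gmap S T) (g : gmap X T) (u : prod_gset S X) a :
  f u.1 == g u.2 -> f (gact u a).1 == g (gact u a).2.
Proof. by move/eqP=> fg; rewrite /= !gmapJ fg. Qed.

Definition fprod (gT : finGroupType) (S X T : gset gT)
    (f : gmap S T) (g : gmap X T) : gset gT :=
  sub_gset (@fprod_subproof gT S X T f g).

Definition fprod_fst (gT : finGroupType) (S X T : gset gT)
    (f : gmap S T) (g : gmap X T) : gmap (fprod f g) S :=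
  @mk_gmap gT (fprod f g) S (fun u => (val u).1) (fun u a => erefl).

Definition fprod_snd (gT : finGroupType) (S X T : gset gT)
    (f : gmap S T) (g : gmap X T) : gmap (fprod f g) X :=
  @mk_gmap gT (fprod f g) X (fun u => (val u).2) (fun u a => erefl).

Lemma fprod_comm (gT : finGroupType) (S X T : gset gT)
    (f : gmap S T) (g : gmap X T) (u : fprod f g) :
  f (val u).1 = g (val u).2.
Proof. exact/eqP/(valP u). Qed.

Lemma fprod_pullback (gT : finGroupType) (S X T : gset gT)
    (f : gmap S T) (g : gmap X T) :
  is_pullback f g (fprod_fst f g) (fprod_snd f g).
Proof.
split=> [|Z u v fugv].
  by apply: gmapP => w; rewrite !gcompE !mk_gmapE; apply: fprod_comm.
have wP z : f (u z) == g (v z) by rewrite -!gcompE fugv.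
pose w z : fprod f g := exist _ (u z, v z) (wP z).
have wJ z a : w (gact z a) = gact (w z) a.
  by apply: val_inj; rewrite /= !gmapJ.
exists (mk_gmap wJ); split.
  by split; apply: gmapP => z; rewrite gcompE !mk_gmapE.
move=> w' [w'u w'v]; apply: gmapP => z; rewrite mk_gmapE; apply: val_inj.
rewrite /= -w'u -w'v !gcompE !mk_gmapE.
exact/esym/surjective_pairing.
Qed.

(* [pb n] and [pb_hom n] are the pullback functor n^* on objects and on
   morphisms. *)
Definition pb (gT : finGroupType) (S T : gset gT) (n : gmap S T)
    (X : over T) : over S :=
  Over (fprod_fst n (over_map X)).

Lemma pb_hom_subproof (gT : finGroupType) (S T : gset gT) (n : gmap S T)
    (X Y : over T) (k : over_hom X Y) (u : fprod n (over_map X)) :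
  n (val u).1 == over_map Y (k (val u).2).
Proof. by rewrite oh_mapE fprod_comm. Qed.

Lemma pb_homJ (gT : finGroupType) (S T : gset gT) (n : gmap S T)
    (X Y : over T) (k : over_hom X Y)
    (to := fun u : over_dom (pb n X) =>
       exist _ ((val u).1, k (val u).2) (pb_hom_subproof k u)
         : over_dom (pb n Y)) u a :
  to (gact u a) = gact (to u) a.
Proof. by apply: val_inj; rewrite /= gmapJ. Qed.

Lemma pb_hom_comm (gT : finGroupType) (S T : gset gT) (n : gmap S T)
    (X Y : over T) (k : over_hom X Y) :
  gcomp (over_map (pb n Y)) (mk_gmap (@pb_homJ gT S T n X Y k))
  == over_map (pb n X).
Proof. by apply/eqP/gmapP=> u; rewrite gcompE !mk_gmapE. Qed.

Definition pb_hom (gT : finGroupType) (S T : gset gT) (n : gmap S T)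
    (X Y : over T) (k : over_hom X Y) : over_hom (pb n X) (pb n Y) :=
  OverHom (pb_hom_comm n k).

Lemma pb_homE (gT : finGroupType) (S T : gset gT) (n : gmap S T)
    (X Y : over T) (k : over_hom X Y) (u : over_dom (pb n X)) :
  val (pb_hom n k u) = ((val u).1, k (val u).2).
Proof. by rewrite mk_gmapE. Qed.

(* A right adjoint n_* of n^*, presented by its values on objects and its
   counit; the universal property of the counit determines its values on
   morphisms. *)
Record pushforward (gT : finGroupType) (S T : gset gT) (n : gmap S T) :=
  Pushforward {
    pf_obj :> over S -> over T;
    pf_counit : forall A : over S, over_hom (pb n (pf_obj A)) A;
    pf_universal : forall (A : over S) (X : over T) (h : over_hom (pb n X) A),
      exists! k : over_hom X (pf_obj A), oh_comp (pf_counit A) (pb_hom n k) = h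
  }.

Lemma section_gset1 (gT : finGroupType) (S A : gset gT)
    (s : {ffun S -> option A}) :
  [ffun x => omap (fun y => gact y 1) (s (gact x 1^-1))] = s.
Proof.
apply/ffunP=> x; rewrite ffunE invg1 /gact act1.
by case: (s x) => //= y; rewrite act1.
Qed.

Lemma section_gsetM (gT : finGroupType) (S A : gset gT)
    (s : {ffun S -> option A}) a b
    (to := fun (s : {ffun S -> option A}) c =>
       [ffun x => omap (fun y => gact y c) (s (gact x c^-1))]) :
  to s (a * b) = to (to s a) b.
Proof.
apply/ffunP=> x; rewrite !ffunE invMg /gact actM.
by case: (s _) => //= y; rewrite actM.
Qed.

Definition section_gset (gT : finGroupType) (S A : gset gT) : gset gT :=
  @mk_gset gT {ffun S -> option A}
    (fun s a => [ffun x => omap (fun y => gact y a) (s (gact x a^-1))])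
    (@section_gset1 gT S A) (@section_gsetM gT S A).

Lemma dprod_subproof (gT : finGroupType) (S T A : gset gT)
    (n : gmap S T) (p : gmap A S)
    (P := fun u : prod_gset T (section_gset S A) =>
       [forall x, omap p (u.2 x) == (if n x == u.1 then Some x else None)])
    (u : prod_gset T (section_gset S A)) (a : gT) :
  P u -> P (gact u a).
Proof.
case: u => t s /forallP Pu; apply/forallP=> x /=.
have := Pu (gact x a^-1); rewrite ffunE gmapJ /=.
have -> : (n x == gact t a) = (gact (n x) a^-1 == t).
  by apply/eqP/eqP=> [->|<-]; rewrite /gact ?actK ?actKV.
case: (s _) => [y|] /=; case: ifP => //= _ /eqP[py].
by rewrite gmapJ py /gact actKV.
Qed.

(* The dependent product of p : A -> S along n : S -> T: the pairs (t, s) with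
   s a section of p over the fibre of n at t. *)
Definition dprod_gset (gT : finGroupType) (S T A : gset gT)
    (n : gmap S T) (p : gmap A S) : gset gT :=
  sub_gset (@dprod_subproof gT S T A n p).

Definition dprod (gT : finGroupType) (S T : gset gT) (n : gmap S T)
    (A : over S) : over T :=
  @Over gT T (dprod_gset n (over_map A))
    (@mk_gmap gT (dprod_gset n (over_map A)) T (fun u => (val u).1)
       (fun _ _ => erefl)).

Lemma dprod_evalP (gT : finGroupType) (S T : gset gT) (n : gmap S T)
    (A : over S) (u : over_dom (pb n (dprod n A))) :
  exists y : over_dom A, (val (val u).2).2 (val u).1 == Some y.
Proof.
have := forallP (valP (val u).2) (val u).1.
rewrite (fprod_comm u) mk_gmapE eqxx.
by case: (_ (val u).1) => // y _; exists y.
Qed.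

Definition dprod_eval (gT : finGroupType) (S T : gset gT) (n : gmap S T)
    (A : over S) (u : over_dom (pb n (dprod n A))) : over_dom A :=
  xchoose (dprod_evalP u).

Lemma dprod_evalE (gT : finGroupType) (S T : gset gT) (n : gmap S T)
    (A : over S) (u : over_dom (pb n (dprod n A))) :
  (val (val u).2).2 (val u).1 = Some (dprod_eval u).
Proof. exact/eqP/(xchooseP (dprod_evalP u)). Qed.

Lemma dprod_evalJ (gT : finGroupType) (S T : gset gT) (n : gmap S T)
    (A : over S) (u : over_dom (pb n (dprod n A))) a :
  dprod_eval (gact u a) = gact (dprod_eval u) a.
Proof.
apply: Some_inj; rewrite -dprod_evalE.
have -> : (val (val (gact u a)).2).2 (val (gact u a)).1 =
   omap (fun y => gact y a)
     ((val (val u).2).2 (gact (gact (val u).1 a) a^-1)) by exact: ffunE.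
by rewrite {2}/gact {2}/gact actK dprod_evalE.
Qed.

Lemma dprod_counit_subproof (gT : finGroupType) (S T : gset gT)
    (n : gmap S T) (A : over S) :
  gcomp (over_map A) (mk_gmap (@dprod_evalJ gT S T n A))
  == over_map (pb n (dprod n A)).
Proof.
apply/eqP/gmapP=> u; rewrite gcompE mk_gmapE [RHS]mk_gmapE.
have := forallP (valP (val u).2) (val u).1.
by rewrite (fprod_comm u) mk_gmapE eqxx dprod_evalE => /eqP[].
Qed.

Definition dprod_counit (gT : finGroupType) (S T : gset gT) (n : gmap S T)
    (A : over S) : over_hom (pb n (dprod n A)) A :=
  OverHom (dprod_counit_subproof n A).

Lemma dprod_universal (gT : finGroupType) (S T : gset gT) (n : gmap S T)
    (A : over S) (X : over T) (h : over_hom (pb n X) A) :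
  exists! k : over_hom X (dprod n A),
    oh_comp (dprod_counit n A) (pb_hom n k) = h.
Proof.
pose F := fprod n (over_map X).
pose s (x : over_dom X) : {ffun S -> option (over_dom A)} :=
  [ffun y => omap h (insub (y, x) : option F)].
have sE (u : F) : s (val u).2 (val u).1 = Some (h u).
  by rewrite ffunE -surjective_pairing valK.
have sN x y : n y != over_map X x -> s x y = None.
  by move=> nyx; rewrite ffunE insubF //=; apply/negbTE.
have kP x : [forall y, omap (over_map A) (s x y)
             == (if n y == over_map X x then Some y else None)].
  apply/forallP=> y; case: ifPn => [nyx|/sN-> //].
  pose u : F := exist _ (y, x) nyx.
  have -> : s x y = Some (h u) by exact: sE u.
  by apply/eqP; congr Some; rewrite (oh_mapE h) mk_gmapE.
pose k0 x : dprod_gset n (over_map A) := exist _ (over_map X x, s x) (kP x).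
have k0J x a : k0 (gact x a) = gact (k0 x) a.
  apply: val_inj; congr (_, _); first exact: gmapJ.
  apply/ffunP=> y; rewrite [RHS]ffunE.
  have E : (n y == over_map X (gact x a)) =
           (n (gact y a^-1) == over_map X x).
    rewrite !gmapJ.
    by apply/eqP/eqP=> [->|<-]; rewrite /gact ?actK ?actKV.
  have [nyx|nyx] := boolP (n (gact y a^-1) == over_map X x); last first.
    by rewrite !sN //= E.
  pose u : F := exist _ (gact y a^-1, x) nyx.
  have -> : s x (gact y a^-1) = Some (h u) by exact: sE u.
  rewrite /= -gmapJ -sE /=; congr (s _ _).
  by rewrite /gact actKV.
have kc : gcomp (over_map (dprod n A)) (mk_gmap k0J) == over_map X.
  by apply/eqP/gmapP=> x; rewrite gcompE !mk_gmapE.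
exists (OverHom kc); split.
  apply/val_inj/gmapP=> u; apply: Some_inj.
  rewrite [X in Some X]gcompE [X in Some X]mk_gmapE -dprod_evalE -sE.
  by rewrite !pb_homE /= (mk_gmapE k0J).
move=> k kh; apply/val_inj/gmapP=> x; apply: val_inj.
rewrite mk_gmapE /=; apply/esym/eqP; rewrite -pair_eqE /=; apply/andP; split.
  by rewrite -(oh_mapE k) mk_gmapE.
apply/eqP/ffunP=> y; have [nyx|nyx] := boolP (n y == over_map X x).
  pose u : F := exist _ (y, x) nyx.
  rewrite (sE u) -kh [X in Some X]gcompE [X in Some X]mk_gmapE.
  by rewrite -dprod_evalE !pb_homE.
rewrite sN //; have := forallP (valP (k x)) y.
have -> : (val (k x)).1 = over_map X x by rewrite -(oh_mapE k) mk_gmapE.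
by rewrite (negbTE nyx); case: (_ y).
Qed.

Definition dependent_product (gT : finGroupType) (S T : gset gT)
    (n : gmap S T) : pushforward n :=
  Pushforward (@dprod_universal gT S T n).

(* All right adjoints of n^* are isomorphic; they exist by
   [dependent_product]. *)
Definition compatible_indexing (gT : finGroupType)
    (Om Oa : indexing_category gT) : Prop :=
  forall (S T : gset gT) (n : gmap S T) (n_ : pushforward n),
    Om S T n ->
    forall A : over S,
      Oa _ _ (over_map A) -> Oa _ _ (over_map (n_ A)).

Record transfer_system (gT : finGroupType) := TransferSystem {
  ts_rel :> {group gT} -> {group gT} -> Prop;
  ts_refl : forall H : {group gT}, ts_rel H H;
  ts_anti : forall K H : {group gT}, ts_rel K H -> ts_rel H K -> K = H;
  ts_trans : forall L K H : {group gT},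
    ts_rel L K -> ts_rel K H -> ts_rel L H;
  ts_sub : forall K H : {group gT}, ts_rel K H -> K \subset H;
  (* [H :^ g^-1] is g H g^-1. *)
  ts_conj : forall (K H : {group gT}) (g : gT),
    ts_rel K H -> ts_rel (K :^ g^-1)%G (H :^ g^-1)%G;
  ts_cap : forall K H L : {group gT},
    ts_rel K H -> ts_rel (K :&: L)%G (H :&: L)%G }.

Definition compatible_transfer (gT : finGroupType)
    (T1 T2 : transfer_system gT) : Prop :=
  (forall K H : {group gT}, T1 K H -> T2 K H) /\
  forall A B C : {group gT}, B \subset A -> C \subset A ->
    T1 B A -> T2 (B :&: C)%G B -> T2 C A.

Lemma lmul_gset1 (gT : finGroupType) (A : {set gT}) : 1^-1 *: A = A.
Proof. by rewrite invg1 lcoset1. Qed.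

Lemma lmul_gsetM (gT : finGroupType) (A : {set gT}) (a b : gT) :
  (a * b)^-1 *: A = b^-1 *: (a^-1 *: A).
Proof. by rewrite invMg lcosetM. Qed.

Definition lmul_gset (gT : finGroupType) : gset gT :=
  @mk_gset gT {set gT} (fun A a => a^-1 *: A)
    (@lmul_gset1 gT) (@lmul_gsetM gT).

Lemma orb_subproof (gT : finGroupType) (H : {group gT})
    (A : lmul_gset gT) (a : gT) :
  A \in lcosets H [set: gT] -> gact A a \in lcosets H [set: gT].
Proof.
case/lcosetsP=> x _ ->; apply/lcosetsP; exists (a^-1 * x); first by rewrite inE.
by rewrite lcosetM.
Qed.

(* G/H as left cosets; by the convention on [gact], G acts on them by left
   translation. *)
Definition orb (gT : finGroupType) (H : {group gT}) : gset gT :=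
  sub_gset (@orb_subproof gT H).

Lemma quot_subproof (gT : finGroupType) (K H : {group gT}) (sKH : K \subset H)
    (A : orb K) :
  val A * H \in lcosets H [set: gT].
Proof.
have/lcosetsP[x _ ->] := valP A; apply/lcosetsP; exists x; first by rewrite inE.
by rewrite -mulgA mulSGid.
Qed.

Lemma quotJ (gT : finGroupType) (K H : {group gT}) (sKH : K \subset H)
    (to := fun A : orb K => exist _ (val A * H) (quot_subproof sKH A) : orb H)
    (A : orb K) (a : gT) :
  to (gact A a) = gact (to A) a.
Proof. by apply: val_inj; exact: esym (mulgA _ _ _). Qed.

(* xK is sent to xH, written as the product set (xK)H. *)
Definition quot (gT : finGroupType) (K H : {group gT}) (sKH : K \subset H) :
  gmap (orb K) (orb H) := mk_gmap (@quotJ gT K H sKH).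

Definition transfer_rel (gT : finGroupType) (O : indexing_category gT)
    (K H : {group gT}) : Prop :=
  exists sKH : K \subset H, O _ _ (quot sKH).

Lemma ic_injective (gT : finGroupType) (O : indexing_category gT)
    (S T : gset gT) (f : gmap S T) : injective f -> O S T f.
Proof.
move=> f_inj.
have CJ (y : T) a : y \notin codom f -> gact y a \notin codom f.
  apply: contra => /codomP[x ya]; apply/codomP; exists (gact x a^-1).
  by rewrite gmapJ -ya /gact actK.
pose C := sub_gset CJ; pose X (b : bool) := if b then S else C.
pose inj (b : bool) : gmap (X b) T :=
  if b is true then f else @mk_gmap gT C T val (fun _ _ => erefl).
suff: is_coproduct_in (@all_gmaps gT) inj.
  by case/(ic_coproduct O) => /(_ true).
split=> // Y g _.
have /fin_all_exists[h hP] y : exists z,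
    (forall x, f x = y -> g true x = z) /\
    (forall c : C, val c = y -> g false c = z).
  have [/codomP[x0 ->]|yC] := boolP (y \in codom f).
    exists (g true x0); split=> [x /f_inj-> //|c cE].
    by have := valP c; rewrite /= cE codom_f.
  exists (g false (exist _ y yC)); split=> [x fx|c cE].
    by case/negP: (yC); rewrite -fx codom_f.
  by congr (g false _); apply: val_inj.
have hf x : h (f x) = g true x by have [/(_ x erefl)] := hP (f x).
have hC (c : C) : h (val c) = g false c by have [_ /(_ c erefl)] := hP (val c).
have hJ y a : h (gact y a) = gact (h y) a.
  have [/codomP[x ->]|yC] := boolP (y \in codom f).
    by rewrite -gmapJ !hf gmapJ.
  by have := hC (gact (exist _ y yC : C) a); rewrite gmapJ -hC.
exists (mk_gmap hJ); split.
  split=> //; case; apply: gmapP => x; rewrite gcompE mk_gmapE //.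
  by rewrite -hC mk_gmapE.
move=> h' [_ h'E]; apply: gmapP => y; rewrite mk_gmapE.
have [/codomP[x ->]|yC] := boolP (y \in codom f).
  by rewrite hf -(h'E true) gcompE.
by have := hC (exist _ y yC : C); rewrite -(h'E false) gcompE mk_gmapE.
Qed.

Lemma transfer_relT (gT : finGroupType) (O : indexing_category gT)
    (L K H : {group gT}) :
  transfer_rel O L K -> transfer_rel O K H -> transfer_rel O L H.
Proof.
case=> sLK OLK [sKH OKH]; exists (subset_trans sLK sKH).
rewrite (_ : quot _ = gcomp (quot sKH) (quot sLK)); first exact: ic_comp.
apply: gmapP => A; rewrite gcompE; apply: val_inj.
by rewrite !mk_gmapE /= -mulgA mulSGid.
Qed.

Lemma transfer_rel_anti (gT : finGroupType) (O : indexing_category gT)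
    (K H : {group gT}) :
  transfer_rel O K H -> transfer_rel O H K -> K = H.
Proof. by case=> sKH _ [sHK _]; apply/val_inj/eqP; rewrite eqEsubset sKH. Qed.

Lemma transfer_rel_refl (gT : finGroupType) (O : indexing_category gT)
    (H : {group gT}) : transfer_rel O H H.
Proof.
exists (subxx H); rewrite (_ : quot _ = gid _); first exact: ic_id.
apply: gmapP => A; rewrite gidE; apply: val_inj; rewrite mk_gmapE /=.
by have/lcosetsP[x _ ->] := valP A; rewrite -mulgA mulGid.
Qed.

Lemma transfer_rel_sub (gT : finGroupType) (O : indexing_category gT)
    (K H : {group gT}) : transfer_rel O K H -> K \subset H.
Proof. by case. Qed.

Lemma transfer_rel_cap (gT : finGroupType) (O : indexing_category gT)
    (K H L : {group gT}) :
  transfer_rel O K H -> transfer_rel O (K :&: L)%G (H :&: L)%G.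
Proof.
case=> sKH OKH; have sI := setSI L sKH; exists sI.
have sKL : (K :&: L)%G \subset K by apply: subsetIl.
have sHL : (H :&: L)%G \subset H by apply: subsetIl.
pose P := fprod (quot sKH) (quot sHL).
have jP (A : orb (K :&: L)%G) :
    quot sKH (quot sKL A) == quot sHL (quot sI A).
  apply/eqP/val_inj; rewrite !mk_gmapE /= -!mulgA.
  by rewrite (mulSGid sKH) (mulSGid sHL).
pose j A : P := exist _ (quot sKL A, quot sI A) (jP A).
have jJ A a : j (gact A a) = gact (j A) a.
  by apply: val_inj; congr (_, _); exact: gmapJ.
rewrite (_ : quot sI = gcomp (fprod_snd _ _) (mk_gmap jJ)).
  apply: ic_comp; first exact: ic_pullback (fprod_pullback _ _) OKH.
  apply: ic_injective => A B; rewrite !mk_gmapE => jAB.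
  have eK : val A * K = val B * K.
    have : quot sKL A = quot sKL B := congr1 (fun u => (val u).1) jAB.
    by move/(congr1 val); rewrite !mk_gmapE.
  have eI : val A * (H :&: L) = val B * (H :&: L).
    have : quot sI A = quot sI B := congr1 (fun u => (val u).2) jAB.
    by move/(congr1 val); rewrite !mk_gmapE.
  apply: val_inj => /=.
  have capE (D : orb (K :&: L)%G) :
      val D = (val D * K) :&: (val D * (H :&: L)%G).
    have /lcosetsP[x _ ->] := valP D.
    rewrite -!mulgA (mulSGid sKL) (mulSGid sI) /=.
    apply/setP=> z; rewrite inE !mem_lcoset !inE.
    by case: (boolP (_ \in K)) => /= [/(subsetP sKH)->|].
  by rewrite capE eK eI -capE.
by apply: gmapP => A; rewrite gcompE (mk_gmapE jJ) [RHS]mk_gmapE.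
Qed.

Lemma iso_pullback (gT : finGroupType) (S T S' T' : gset gT)
    (f : gmap S T) (f' : gmap S' T') (a : gmap S' S) (b : gmap T' T)
    (a' : gmap S S') (b' : gmap T T') :
  cancel a a' -> cancel a' a -> cancel b b' ->
  gcomp f a = gcomp b f' -> is_pullback f b a f'.
Proof.
move=> aK a'K bK fab; split=> // Z u v fubv.
have E x : b (f' x) = f (a x) by rewrite -!gcompE fab.
have E' z : f (u z) = b (v z) by rewrite -!gcompE fubv.
exists (gcomp a' u); split.
  split; apply: gmapP => z; rewrite !gcompE ?a'K //.
  by apply: (can_inj bK); rewrite E a'K E'.
by move=> w [wu _]; apply: gmapP => z; rewrite -wu !gcompE aK.
Qed.

Lemma orb_rmul (gT : finGroupType) (L M : {group gT}) (x : gT) :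
  M :=: L :^ x ->
  exists c : gmap (orb L) (orb M), forall A, val (c A) = val A :* x.
Proof.
move=> defM.
have cP (A : orb L) : val A :* x \in lcosets M [set: gT].
  have /lcosetsP[y _ ->] := valP A; apply/lcosetsP.
  exists (y * x); first by rewrite inE.
  rewrite defM conjsgE -mulg_set1 -!mulgA (mulgA [set x]).
  by rewrite mulg_set1 mulgV mul1g.
pose c (A : orb L) : orb M := exist _ (val A :* x) (cP A).
have cJ (A : orb L) a : c (gact A a) = gact (c A) a.
  by apply: val_inj; exact: esym (mulgA _ _ _).
by exists (mk_gmap cJ) => A; rewrite mk_gmapE.
Qed.

Lemma transfer_rel_conj (gT : finGroupType) (O : indexing_category gT)
    (K H : {group gT}) (g : gT) :
  transfer_rel O K H -> transfer_rel O (K :^ g^-1)%G (H :^ g^-1)%G.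
Proof.
case=> sKH OKH.
have sKHg : (K :^ g^-1)%G \subset (H :^ g^-1)%G by rewrite conjSg.
exists sKHg.
have J (L : {group gT}) : L :=: (L :^ g^-1)%G :^ g by rewrite /= conjsgKV.
have [a aE] := @orb_rmul gT (K :^ g^-1)%G K g (J K).
have [a' a'E] := @orb_rmul gT K (K :^ g^-1)%G g^-1 erefl.
have [b bE] := @orb_rmul gT (H :^ g^-1)%G H g (J H).
have [b' b'E] := @orb_rmul gT H (H :^ g^-1)%G g^-1 erefl.
have aK : cancel a a' by move=> A; apply: val_inj; rewrite a'E aE rcosetK.
have a'K : cancel a' a by move=> A; apply: val_inj; rewrite aE a'E rcosetKV.
have bK : cancel b b' by move=> A; apply: val_inj; rewrite b'E bE rcosetK.
apply: ic_pullback (iso_pullback aK a'K bK _) OKH.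
apply: gmapP => A; rewrite !gcompE; apply: val_inj.
rewrite bE !mk_gmapE /= aE -!mulgA; congr (_ * _).
by rewrite conjsgE invgK -!mulgA mulg_set1 mulVg mulg1.
Qed.

Definition transfer_of (gT : finGroupType) (O : indexing_category gT) :
    transfer_system gT :=
  @TransferSystem gT (transfer_rel O) (@transfer_rel_refl gT O)
    (@transfer_rel_anti gT O) (@transfer_relT gT O) (@transfer_rel_sub gT O)
    (@transfer_rel_conj gT O) (@transfer_rel_cap gT O).

(* Main.v *)
(* An indexing category O is determined by its transfer system T: a G-map f is
   in O iff Stab(x) <=_T Stab(f x) for all x, because a G-set is a coproduct of
   orbits.  So compatibility is a statement about the stabilizers of the points
   (t, s) of a dependent product: if H = Stab(t), this is the set of the a in H
   for which the section s over the fibre of t commutes with a.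

   If the transfer systems are compatible, induct on |H| and the size of an
   H-stable set F of points over which s is considered.  As <=_{T_a} is closed
   under intersections of subgroups of H, F may be taken to be a single orbit
   H x with stabilizer B; if C is the stabilizer of s in H, induction applied
   to B acting on the same F gives B :&: C <=_{T_a} B, whence C <=_{T_a} H.

   Conversely, given B <=_{T_m} A and B :&: C <=_{T_a} B, consider the pairs
   (y, Z), where y is a coset of B and Z is either empty or a coset of B :&: C
   contained in y.  The projection to G/B is in O_a, and the stabilizer in A of
   the section y |-> (y, y :&: C) over A/B is exactly C.  The inclusion
   T_m <= T_a is the case C = B. *)
Require Import Defs.
From mathcomp Require Import all_boot all_fingroup.

Set Implicit Arguments.
Unset Strict Implicit.
Unset Printing Implicit Defensive.

(* [Defs] again: its [gact] is shadowed by the one of mathcomp's action.v. *)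
Import GroupScope Defs.

(** * Point stabilizers and orbit maps *)

Section Stabilizers.

Variables (gT : finGroupType) (X : gset gT).
Implicit Types (x : X) (a b : gT).

Definition gstab x : {group gT} := [group of 'C[x | gset_act X]].

Lemma gstabP x a : reflect (gact x a = x) (a \in gstab x).
Proof. exact: astab1P. Qed.

Lemma gactM x a b : gact x (a * b) = gact (gact x a) b.
Proof. exact: actM. Qed.

Lemma gact1 x : gact x 1 = x.
Proof. exact: act1. Qed.

Lemma gactK x a : gact (gact x a) a^-1 = x.
Proof. exact: actK. Qed.

Lemma gactKV x a : gact (gact x a^-1) a = x.
Proof. exact: actKV. Qed.

(** In left-action terms, gK |-> g . x with K the stabilizer of x does not depend on g; [repr] picks
    some g. *)
Lemma orbit_map_subproof x (A : orb (gstab x)) g :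
  g \in val A -> gact x (repr (val A))^-1 = gact x g^-1.
Proof.
have /lcosetsP[h _ ->] := valP A => gA.
have := mem_repr g gA; move: (repr _) => r.
have cE z : z \in h *: gstab x -> gact x z^-1 = gact x h^-1.
  case/lcosetP=> k kx ->; rewrite invMg gactM.
  by congr gact; apply/gstabP; rewrite groupV.
by move=> /cE->; rewrite cE.
Qed.

Lemma orbit_mapJ x (A : orb (gstab x)) a :
  gact x (repr (val (gact A a)))^-1 = gact (gact x (repr (val A))^-1) a.
Proof.
have rA : repr (val A) \in val A.
  by have /lcosetsP[h _ ->] := valP A; apply: mem_repr (lcoset_refl _ h).
rewrite (@orbit_map_subproof x _ (a^-1 * repr (val A))) ?invMg ?invgK ?gactM //.
by rewrite /= mem_lcoset invgK mulKVg.
Qed.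

Definition orbit_map x : gmap (orb (gstab x)) X := mk_gmap (@orbit_mapJ x).

Lemma orbit_mapE x (A : orb (gstab x)) g :
  g \in val A -> orbit_map x A = gact x g^-1.
Proof. by rewrite mk_gmapE; apply: orbit_map_subproof. Qed.

Lemma orbit_map_surj x a : exists A, orbit_map x A = gact x a.
Proof.
have P : a^-1 *: gstab x \in lcosets (gstab x) [set: gT].
  by apply/lcosetsP; exists a^-1; rewrite ?inE.
exists (exist _ (a^-1 *: gstab x : lmul_gset gT) P).
by rewrite (@orbit_mapE _ _ a^-1) ?invgK //= lcoset_refl.
Qed.

Lemma orbit_map_inj x : injective (orbit_map x).
Proof.
move=> A B; have /lcosetsP[g _ gA] := valP A; have /lcosetsP[h _ hB] := valP B.
rewrite (@orbit_mapE _ A g) ?gA ?lcoset_refl //.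
rewrite (@orbit_mapE _ B h) ?hB ?lcoset_refl // => E.
apply: val_inj; rewrite gA hB; apply/lcoset_eqP; rewrite mem_lcoset.
rewrite -groupV; apply/gstabP.
by rewrite invMg invgK gactM E gactKV.
Qed.

End Stabilizers.

Lemma gstab_gmap (gT : finGroupType) (X Y : gset gT) (f : gmap X Y) (x : X) :
  gstab x \subset gstab (f x).
Proof. by apply/subsetP=> a /gstabP ax; apply/gstabP; rewrite -gmapJ ax. Qed.

(** On the orbit of x, [f] becomes the quotient G/Stab(x) -> G/Stab(f x). *)
Lemma orbit_map_quot (gT : finGroupType) (X Y : gset gT) (f : gmap X Y)
    (x : X) :
  gcomp f (orbit_map x) = gcomp (orbit_map (f x)) (quot (gstab_gmap f x)).
Proof.
apply: gmapP => A; rewrite !gcompE; have /lcosetsP[g _ gA] := valP A.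
rewrite (@orbit_mapE _ _ _ A g) ?gA ?lcoset_refl // gmapJ.
rewrite (@orbit_mapE _ _ _ _ g) //.
rewrite mk_gmapE /= gA -mulgA mulSGid ?gstab_gmap //; exact: lcoset_refl.
Qed.

(** * Membership in an indexing category, read off from stabilizers *)

Lemma orbit_coproduct (gT : finGroupType) (X : gset gT) :
  exists R : {set X},
    is_coproduct_in (@all_gmaps gT)
      (fun i : {x | x \in R} => orbit_map (val i)).
Proof.
pose to := gset_act X.
have GX : [acts [set: gT], on [set: X] | to].
  by apply/subsetP=> a _; rewrite !inE; apply/subsetP=> x; rewrite !inE.
have [_ RX Rinj Rrep] := orbit_transversalP GX.
set R := orbit_transversal _ _ _ in RX Rinj Rrep.
exists R; split=> // Y f _.
(* The transversal meets each orbit once and orbit maps are injective, so each point has one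
   preimage and the cocone [f] glues to a function on X. *)
have uniq_pre i j (A : orb (gstab (val i))) (B : orb (gstab (val j))) :
    orbit_map (val i) A = orbit_map (val j) B -> f i A = f j B.
  move=> E.
  have ij : i = j.
    have /lcosetsP[g _ gA] := valP A; have /lcosetsP[h _ hB] := valP B.
    move: E; rewrite (@orbit_mapE _ _ _ A g) ?gA ?lcoset_refl //.
    rewrite (@orbit_mapE _ _ _ B h) ?hB ?lcoset_refl // => E.
    apply/val_inj/eqP.
    rewrite -(Rinj _ _ (valP i) (valP j)); apply/orbitP.
    exists (g^-1 * h); rewrite ?inE //.
    by rewrite -[LHS]/(gact (val i) _) gactM E gactKV.
  by subst j; rewrite (orbit_map_inj E).
have /fin_all_exists[h hE] (x : X) : exists z,
    forall i A, orbit_map (val i) A = x -> f i A = z.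
  have [|a _ xaR] := Rrep x; first by rewrite inE.
  have [A AE] := @orbit_map_surj _ _ (gact x a) a^-1.
  exists (f (exist _ (gact x a) xaR) A) => j B BE.
  by apply: uniq_pre; rewrite BE /= AE gactK.
have surj (x : X) : exists i : {x | x \in R}, exists A, orbit_map (val i) A = x.
  have [|a _ xaR] := Rrep x; first by rewrite inE.
  have [A AE] := @orbit_map_surj _ _ (gact x a) a^-1.
  by exists (exist _ (gact x a) xaR), A; rewrite AE gactK.
have hE' i A : h (orbit_map (val i) A) = f i A by rewrite -(hE _ i A).
have hJ x a : h (gact x a) = gact (h x) a.
  by have [i [A <-]] := surj x; rewrite -gmapJ !hE' gmapJ.
exists (mk_gmap hJ); split.
  by split=> // i; apply: gmapP => A; rewrite gcompE mk_gmapE hE'.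
move=> h' [_ h'E]; apply: gmapP => x; rewrite mk_gmapE.
by have [i [A <-]] := surj x; rewrite hE' -h'E gcompE.
Qed.

Lemma ic_gstab (gT : finGroupType) (O : indexing_category gT) (X Y : gset gT)
    (f : gmap X Y) :
  O X Y f <-> forall x, transfer_rel O (gstab x) (gstab (f x)).
Proof.
split=> [Of x | Tf].
  exists (gstab_gmap f x).
  have Ofx : O _ _ (gcomp f (orbit_map x)).
    exact: ic_comp Of (ic_injective _ (@orbit_map_inj _ _ x)).
  (* As [orbit_map (f x)] is injective, [quot] is the base change along it of [f] composed with
     [orbit_map x]. *)
  apply: (@ic_pullback _ O _ _ _ _ _ (orbit_map (f x)) (gid _)) Ofx.
  split=> [|Z u v].
    by rewrite -orbit_map_quot; apply: gmapP => A; rewrite gcompE gidE.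
  rewrite orbit_map_quot => uv; exists u; split.
    split; apply: gmapP => z; rewrite gcompE ?gidE //.
    by apply: (@orbit_map_inj _ _ (f x)); rewrite -[RHS]gcompE -uv !gcompE.
  by move=> w [wu _]; apply: gmapP => z; rewrite -wu gcompE gidE.
(* The coproduct in O yields a map h of O agreeing with [f] on every orbit; uniqueness among all
   G-maps gives f = h. *)
have [R coprod] := orbit_coproduct X.
have [_ /(_ _ (fun i => gcomp f (orbit_map (val i))))] :=
  ic_coproduct O coprod.
case=> [i|h [[Oh hE] _]].
  rewrite orbit_map_quot; apply: ic_comp.
    exact/ic_injective/orbit_map_inj.
  by have [s] := Tf (val i); rewrite (bool_irrelevance s (gstab_gmap f _)).
suff -> : f = h by [].
have [_ /(_ _ (fun i => gcomp f (orbit_map (val i))))] := coprod.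
case=> // k [_ uniqk].
by rewrite -(uniqk f) ?(uniqk h) //; split.
Qed.

(** The counits induce mutually inverse comparison maps. Injectivity is what is recorded, since
    injective maps lie in every indexing category. *)
Lemma pushforward_unique (gT : finGroupType) (S T : gset gT) (n : gmap S T)
    (m_ n_ : pushforward n) (A : over S) :
  exists k : over_hom (m_ A) (n_ A), injective k.
Proof.
have [k [kE _]] := @pf_universal _ _ _ _ n_ A _ (pf_counit m_ A).
have [l [lE _]] := @pf_universal _ _ _ _ m_ A _ (pf_counit n_ A).
exists k; suff lk x : l (k x) = x by apply: can_inj lk.
have [i [_ uniqi]] := @pf_universal _ _ _ _ m_ A _ (pf_counit m_ A).
have idP : gcomp (over_map (m_ A)) (gid _) == over_map (m_ A).
  by apply/eqP/gmapP=> y; rewrite gcompE gidE.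
have E : OverHom idP = oh_comp l k.
  rewrite -(uniqi (OverHom idP)); last first.
    apply/val_inj/gmapP=> u; rewrite [LHS]gcompE; congr (pf_counit _ _ _).
    by apply: val_inj; rewrite [LHS]pb_homE gidE -surjective_pairing.
  apply: uniqi; apply/val_inj/gmapP=> u; rewrite -[in RHS]kE -lE.
  rewrite [LHS]gcompE [RHS]gcompE [in RHS]gcompE; congr (pf_counit _ _ _).
  by apply: val_inj; rewrite [LHS]pb_homE [RHS]pb_homE pb_homE gcompE.
by have := congr1 (fun h : over_hom _ _ => h x) E; rewrite /= gcompE gidE.
Qed.

(** * The induction over compatible transfer systems *)

Section TransferSystems.

Variable gT : finGroupType.
Implicit Types (T : transfer_system gT) (H K L : {group gT}).

Lemma ts_eq T K K' H H' : K :=: K' -> H :=: H' -> T K H -> T K' H'.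
Proof. by move=> /group_inj-> /group_inj->. Qed.

Lemma ts_inter T K L H : T K H -> T L H -> T (K :&: L)%G H.
Proof.
move=> TKH TLH; apply: (ts_trans _ TLH).
by apply: ts_eq (ts_cap L TKH) => //=; apply/setIidPr/(ts_sub TLH).
Qed.

Variables (X Y : gset gT) (s : X -> Y).

(** When F is a fibre and H the stabilizer of its base point, this is the stabilizer of the section
    [s]. *)
Definition equivariance_set (H : {set gT}) (F : {set X}) : {set gT} :=
  [set a in H | [forall y in F, s (gact y a) == gact (s y) a]].

Lemma equivariance_setP (H : {set gT}) (F : {set X}) a :
  reflect (a \in H /\ {in F, forall y, s (gact y a) = gact (s y) a})
          (a \in equivariance_set H F).
Proof.
rewrite inE; apply: (iffP andP) => -[aH sa]; split=> //.
  by move=> y yF; apply/eqP/(forall_inP sa).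
by apply/forall_inP => y yF; apply/eqP/sa.
Qed.

Lemma equivariance_group_set H (F : {set X}) :
  [acts H, on F | gset_act X] -> group_set (equivariance_set H F).
Proof.
move=> HF; apply/group_setP; split.
  by apply/equivariance_setP; split=> // y _; rewrite !gact1.
move=> a b /equivariance_setP[aH sa] /equivariance_setP[bH sb].
apply/equivariance_setP; split=> [|y yF]; first exact: groupM.
by rewrite !gactM sb ?sa // -[gact y a]/(gset_act X y a) (acts_act HF).
Qed.

Definition equivariance_group H (F : {set X})
    (HF : [acts H, on F | gset_act X]) :=
  Group (equivariance_group_set HF).

Variables (Tm Ta : transfer_system gT).
Hypothesis comp : compatible_transfer Tm Ta.

Lemma transfer_equivariance H (F : {set X})
    (HF : [acts H, on F | gset_act X]) :
  {in F, forall y, Tm (gstab y :&: H)%G H} ->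
  {in F, forall y, Ta (gstab (s y) :&: H)%G (gstab y :&: H)%G} ->
  Ta (equivariance_group HF) H.
Proof.
have [n] := ubnP (#|H| + #|F|)%N.
elim: n => // n IH in H F HF * => ltn Fm Fa.
have [F0|[x xF]] := set_0Vmem F.
  apply: ts_eq (ts_refl Ta H) => //=; apply/setP=> a.
  by apply/idP/equivariance_setP => [aH|[]//]; split=> // y; rewrite F0 inE.
set O := orbit (gset_act X) H x.
have xO : x \in O by apply: orbit_refl.
have HO : [acts H, on O | gset_act X] by apply: acts_orbit; apply: subsetT.
have sOF : O \subset F by rewrite acts_sub_orbit.
(* With several orbits, split off O: equivariance over F is equivariance over both O and its
   complement, each smaller than F. *)
have [eFO|neFO] := eqVneq F O; last first.
  have ltOF : O \proper F by rewrite properEneq eq_sym neFO.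
  have ltDF : F :\: O \proper F.
    by rewrite properEneq subsetDl andbT; apply/eqP=> /setP/(_ x);
       rewrite !inE xF xO.
  have HD : [acts H, on F :\: O | gset_act X].
    apply/subsetP=> a aH; rewrite !inE; apply/subsetP=> y.
    by rewrite !inE (acts_act HF) // (acts_act HO).
  have TO : Ta (equivariance_group HO) H.
    apply: IH => [|y /(subsetP sOF)/Fm//|y /(subsetP sOF)/Fa//].
    by rewrite -ltnS (leq_trans _ ltn) // !ltnS ltn_add2l proper_card.
  have TD : Ta (equivariance_group HD) H.
    apply: IH => [|y /setDP[/Fm//]|y /setDP[/Fa//]].
    by rewrite -ltnS (leq_trans _ ltn) // !ltnS ltn_add2l proper_card.
  apply: ts_eq (ts_inter TO TD) => //=; apply/setP=> a; rewrite inE.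
  apply/andP/equivariance_setP.
    case=> /equivariance_setP[aH sO] /equivariance_setP[_ sD]; split=> // y yF.
    by have [/sO//|yO] := boolP (y \in O); apply: sD; rewrite inE yO.
  case=> aH sF; split; apply/equivariance_setP; split=> // y.
    by move/(subsetP sOF)/sF.
  by case/setDP=> /sF.
set B := (gstab x :&: H)%G.
have sBH : B \subset H by apply: subsetIr.
have BF : [acts B, on F | gset_act X] := subset_trans sBH HF.
(* If B = H, passing to B would not decrease the measure; but then F is {x} and the group is the
   stabilizer of [s x] in H. *)
have [eBH|neBH] := eqVneq (B : {set gT}) H.
  apply: ts_eq (Fa x xF) => //=; apply/setP=> a; rewrite inE andbC.
  have fixx b : b \in H -> gact x b = x.
    by rewrite -eBH => /setIP[/gstabP].
  apply/andP/equivariance_setP.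
    case=> aH /gstabP sa; split=> // y; rewrite eFO => /orbitP[b bH <-].
    by rewrite -[gset_act X x b]/(gact x b) fixx // fixx.
  by case=> aH /(_ x xF); rewrite fixx // => sa; split=> //; apply/gstabP.
have ltBH : B \proper H by rewrite properEneq neBH.
have sCH : equivariance_group HF \subset H.
  by apply/subsetP=> a /equivariance_setP[].
(* With C the group in the goal, B :&: C is the equivariance group of B on F, to which induction
   applies. *)
apply: (comp.2 _ B) => //; first exact: Fm.
have TB : Ta (equivariance_group BF) B.
  apply: IH => [|y yF|y yF].
  - by rewrite -ltnS (leq_trans _ ltn) // !ltnS ltn_add2r proper_card.
  - apply: ts_eq (ts_cap B (Fm y yF)) => /=.
      by rewrite -setIA; congr (_ :&: _); apply/setIidPr.
    exact/setIidPr.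
  by apply: ts_eq (ts_cap B (Fa y yF)) => /=;
     rewrite -setIA; congr (_ :&: _); apply/setIidPr.
apply: ts_eq TB => //; apply/setP=> a; rewrite [RHS]inE.
apply/equivariance_setP/andP => [[aB sa]|[aB]].
  by split=> //; apply/equivariance_setP; split=> //; apply: (subsetP sBH).
by case/equivariance_setP.
Qed.

End TransferSystems.

(** * Points of a dependent product and their stabilizers *)

Section DependentProductStabilizers.

Variable gT : finGroupType.

Lemma option_gset1 (A : gset gT) (o : option A) :
  omap (fun y => gact y 1) o = o.
Proof. by case: o => //= y; rewrite gact1. Qed.

Lemma option_gsetM (A : gset gT) (o : option A) a b :
  omap (fun y => gact y (a * b)) o
  = omap (fun y => gact y b) (omap (fun y => gact y a) o).
Proof. by case: o => //= y; rewrite gactM. Qed.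

(** [None], the value of a section off its fibre, is a fixed point. *)
Definition option_gset (A : gset gT) : gset gT :=
  @mk_gset gT (option A) (fun o a => omap (fun y => gact y a) o)
    (@option_gset1 A) (@option_gsetM A).

Lemma gstab_Some (A : gset gT) (y : A) :
  gstab (Some y : option_gset A) = gstab y.
Proof.
apply/group_inj/setP=> a.
by apply/gstabP/gstabP=> [[]|ya] //; congr Some.
Qed.

Variables (S T : gset gT) (n : gmap S T) (A : over S).

Lemma gstab_dprod (u : over_dom (dprod n A)) :
  gstab u :=: equivariance_set
    ((val u).2 : S -> option_gset (over_dom A))
    (gstab (val u).1) (n @^-1: [set (val u).1]).
Proof.
set t := (val u).1; set s := (val u).2.
apply/setP=> a; apply/gstabP/equivariance_setP.
  move=> /(congr1 val) /= ua; have ta : gact t a = t := congr1 fst ua.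
  split=> [|y _]; first exact/gstabP.
  have /ffunP/(_ (gact y a)) := congr1 snd ua.
  by rewrite ffunE gactK => <-.
case=> /gstabP ta sa; apply: val_inj.
suff sE : [ffun x => omap (fun y => gact y a) (s (gact x a^-1))] = s.
  rewrite [RHS]surjective_pairing -/t -/s -[in RHS]ta -[in RHS]sE.
  exact: surjective_pairing.
apply/ffunP=> x; rewrite ffunE.
have [nx|nx] := eqVneq (n (gact x a^-1)) t.
  by rewrite -{2}[x](gactKV x a) sa // !inE nx.
(* Since a fixes t, it preserves the complement of the fibre, where both sides are [None]. *)
have Ps y : n y != t -> s y = None.
  move=> ny; have := forallP (valP u) y.
  by rewrite -/t -/s (negbTE ny); case: (s y).
rewrite !Ps //; apply: contra nx => /eqP nx.
by rewrite gmapJ nx -[X in gact X _]ta gactK.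
Qed.

Lemma dprod_section (u : over_dom (dprod n A)) y :
  n y = (val u).1 -> exists2 z, (val u).2 y = Some z & over_map A z = y.
Proof.
move=> ny; have := forallP (valP u) y; rewrite ny eqxx.
by case: (_ y) => //= z /eqP[zy]; exists z.
Qed.

End DependentProductStabilizers.

(** * From transfer systems to indexing categories *)

Lemma compatible_transfer_indexing (gT : finGroupType)
    (Om Oa : indexing_category gT) :
  compatible_transfer (transfer_of Om) (transfer_of Oa) ->
  compatible_indexing Om Oa.
Proof.
move=> comp S T n n_ On A OA.
(* The given pushforward embeds over T into the explicit one, so the latter is enough. *)
have [k k_inj] := pushforward_unique n_ (dependent_product n) A.
have /eqP <- := oh_comm k; apply: ic_comp (ic_injective _ k_inj).
apply/ic_gstab=> u; rewrite mk_gmapE.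
set t := (val u).1.
have HF : [acts gstab t, on n @^-1: [set t] | gset_act S].
  apply/subsetP=> a /gstabP ta; rewrite !inE; apply/subsetP=> y.
  by rewrite !inE -[gset_act S y a]/(gact y a) gmapJ => /eqP->; rewrite ta.
apply: (@ts_eq _ (transfer_of Oa) _ _ _ _ _ erefl
  (transfer_equivariance comp (s := (val u).2 : S -> option_gset _) HF _ _)).
- by rewrite gstab_dprod.
- move=> y; rewrite !inE => /eqP ny; have := (ic_gstab Om n).1 On y.
  rewrite ny => Ty; apply: ts_eq (Ty : transfer_of Om _ _) => //=.
  by apply/esym/setIidPl; have := gstab_gmap n y; rewrite ny.
move=> y; rewrite !inE => /eqP /dprod_section[z -> zy]; rewrite gstab_Some.
by apply: ts_cap; have := (ic_gstab Oa (over_map A)).1 OA z; rewrite zy.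
Qed.

(** * Left cosets and the G-set of partial cosets *)

Section LeftCosets.

Variable gT : finGroupType.
Implicit Types H K : {group gT}.

Lemma gstab_lcoset H g : gstab (g *: H : lmul_gset gT) :=: H :^ g^-1.
Proof.
apply/setP=> a; rewrite mem_conjg invgK -[RHS]groupV -conjVg.
have -> : (a^-1 ^ g \in H) = (a^-1 * g \in g *: H) by rewrite mem_lcoset.
have E : gact (g *: H : lmul_gset gT) a = (a^-1 * g) *: H by rewrite lcosetM.
by apply/gstabP/lcoset_eqP; rewrite E.
Qed.

Lemma gstab_sub (X : gset gT) (P : pred X)
    (PJ : forall x a, P x -> P (gact x a)) (u : sub_gset PJ) :
  gstab u = gstab (val u).
Proof.
apply/group_inj/setP=> a.
by apply/gstabP/gstabP=> [/(congr1 val)|ua] //; apply: val_inj.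
Qed.

Lemma gstab_orb H (A : orb H) g : val A = g *: H -> gstab A :=: H :^ g^-1.
Proof. by move=> gA; rewrite gstab_sub gA gstab_lcoset. Qed.

Lemma gstab_prod (X Y : gset gT) (u : prod_gset X Y) :
  gstab u :=: gstab u.1 :&: gstab u.2.
Proof.
apply/setP=> a; rewrite [RHS]inE; apply/idP/andP.
  by move/gstabP=> ua; split; apply/gstabP; rewrite -[in RHS]ua.
case=> /gstabP xa /gstabP ya; apply/gstabP.
by rewrite [RHS]surjective_pairing -[in RHS]xa -[in RHS]ya.
Qed.

Lemma gstab_set0 : gstab (set0 : lmul_gset gT) :=: setT.
Proof.
apply/setP=> a; rewrite [RHS]inE; apply/gstabP.
by rewrite /gact /= -lcosetE /lcoset imset0.
Qed.

Variables B C : {group gT}.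

Definition partial_coset (u : prod_gset (orb B) (lmul_gset gT)) : bool :=
  (u.2 == set0)
  || (u.2 \in lcosets (B :&: C) [set: gT]) && (u.2 \subset val u.1).

Lemma partial_cosetJ u a : partial_coset u -> partial_coset (gact u a).
Proof.
case/orP=> [/eqP u0|/andP[uD uB]]; apply/orP; [left|right].
  by rewrite /= u0 /gact /= -lcosetE /lcoset imset0.
apply/andP; split; first exact: (@orb_subproof _ (B :&: C)%G).
by apply: mulgS.
Qed.

Definition partial_coset_gset := sub_gset partial_cosetJ.

Definition partial_coset_fst : gmap partial_coset_gset (orb B) :=
  @mk_gmap _ partial_coset_gset (orb B) (fun u => (val u).1)
    (fun _ _ => erefl).

(** Over y = gB, the point (y, g(B :&: C)) calls for the hypothesis conjugated by g; (y, [set0]) has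
    the stabilizer of y and calls for reflexivity. *)
Lemma ic_partial_coset_fst (O : indexing_category gT) :
  transfer_rel O (B :&: C)%G B -> O _ _ partial_coset_fst.
Proof.
move=> OB; apply/ic_gstab=> v; rewrite mk_gmapE.
have := valP v; rewrite (gstab_sub v); move: (val v) => [y Z] /=.
case/orP=> /= [/eqP->|/andP[/lcosetsP[g _ ->] gDy]].
  apply: (@ts_eq _ (transfer_of O) (gstab y) _ (gstab y)) => //.
    by rewrite gstab_prod gstab_set0 setIT.
  exact: transfer_rel_refl.
have yE : val y = g *: B.
  have /lcosetsP[h _ hy] := valP y; rewrite hy; apply/esym/lcoset_eqP.
  by rewrite -hy (subsetP gDy) // (@lcoset_refl _ (B :&: C)%G).
apply: (@ts_eq _ (transfer_of O) _ _ _ _ _ _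
  (@ts_conj _ (transfer_of O) _ _ g OB)).
  rewrite gstab_prod (gstab_orb yE) (@gstab_lcoset (B :&: C)%G) /=.
  by apply/esym/setIidPr; rewrite conjSg subsetIl.
by rewrite (gstab_orb yE).
Qed.

(** If c lies in y :&: C, then y = cB and C = cC, so y :&: C = c(B :&: C). *)
Lemma partial_coset_capP (y : orb B) : partial_coset (y, val y :&: C).
Proof.
rewrite /partial_coset /= subsetIl andbT.
have [->|[c /setIP[cy cC]]] := set_0Vmem (val y :&: C); first by rewrite eqxx.
apply/orP; right; apply/lcosetsP; exists c; rewrite ?inE //.
have /lcosetsP[g _ gy] := valP y.
have -> : val y = c *: B by rewrite gy; apply/esym/lcoset_eqP; rewrite -gy.
apply/setP=> z; rewrite inE !mem_lcoset inE; congr (_ && _).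
by rewrite groupMl // groupV.
Qed.

Definition partial_coset_cap (y : orb B) : partial_coset_gset :=
  exist _ (y, val y :&: C) (partial_coset_capP y).

End LeftCosets.

(** * From indexing categories to transfer systems *)

Lemma compatible_indexing_cap (gT : finGroupType)
    (Om Oa : indexing_category gT) (A B C : {group gT}) :
  compatible_indexing Om Oa -> C \subset A ->
  transfer_rel Om B A -> transfer_rel Oa (B :&: C)%G B -> transfer_rel Oa C A.
Proof.
move=> comp sCA [sBA OmBA] OaCB.
set n := quot sBA in OmBA; pose p := partial_coset_fst B C.
(* [b] is the coset B and [t] the coset A, with stabilizer A; [u] will be the section y |-> (y, y
   :&: C) over A/B. *)
have bP : 1 *: B \in lcosets B [set: gT].
  by apply/lcosetsP; exists 1; rewrite ?inE.
pose b : orb B := exist _ (1 *: B : lmul_gset gT) bP.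
pose t := n b; have tE : val t = 1 *: A.
  by rewrite /t mk_gmapE /= !mul1g mulSGid.
have gtA : gstab t :=: A by rewrite (gstab_orb tE) invg1 conjsg1.
pose s : {ffun orb B -> option (partial_coset_gset B C)} :=
  [ffun y => if n y == t then Some (partial_coset_cap C y) else None].
have uP : [forall y, omap p (s y) == if n y == t then Some y else None].
  by apply/forallP=> y; rewrite ffunE; case: ifP => // _;
     apply/eqP; apply: (congr1 Some); apply: mk_gmapE.
pose u : over_dom (dprod n (Over p)) := exist _ (t, s) uP.
have := comp _ _ n (dependent_product n) OmBA (Over p)
  (ic_partial_coset_fst OaCB).
move/ic_gstab/(_ u); rewrite mk_gmapE.
apply: (@ts_eq _ (transfer_of Oa)); last exact: gtA.
have nJ y a : a \in A -> n y = t -> n (gact y a) = t.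
  by rewrite -gtA => /gstabP ta ny; rewrite gmapJ ny.
have sE y : n y = t -> s y = Some (partial_coset_cap C y).
  by move=> ny; rewrite ffunE ny eqxx.
have sJ y a : n y = t -> n (gact y a) = t ->
    s (gact y a) = omap (fun z => gact z a) (s y) <->
    (a^-1 *: val y) :&: C = a^-1 *: (val y :&: C).
  move=> ny nya; rewrite !sE //; split=> [|E].
    by move/Some_inj/(congr1 (fun z : partial_coset_gset B C => (val z).2)).
  by congr Some; apply: val_inj; congr (_, _).
rewrite gstab_dprod [gval _]gtA; apply/setP=> a; apply/equivariance_setP/idP.
  (* At the coset [b], the element a^-1 lies in a^-1 (b :&: C), as 1 lies in b and C; by
     equivariance it lies in C. *)
  case=> aA /(_ b); rewrite !inE eqxx => /(_ isT).
  move/(sJ b a erefl (nJ b a aA erefl)).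
  move/setP/(_ a^-1); rewrite !inE !mem_lcoset invgK mulgV inE group1.
  have -> : 1 \in val b := lcoset_refl B 1.
  by rewrite invg1 mulg1 group1 groupV.
(* Translation by an element of C preserves C, so it commutes with intersecting with C. *)
move=> aC; have aA := subsetP sCA a aC; split=> // y.
rewrite !inE => /eqP ny; apply/(sJ y a ny (nJ y a aA ny)).
by apply/setP=> z; rewrite !inE !mem_lcoset inE invgK groupMl.
Qed.

Theorem theorem2 (gT : finGroupType) (Om Oa : indexing_category gT) :
  compatible_indexing Om Oa <->
  compatible_transfer (transfer_of Om) (transfer_of Oa).
Proof.
split=> [comp|]; last exact: compatible_transfer_indexing.
split=> [K H TKH|A B C _ sCA]; last exact: compatible_indexing_cap.
apply: (compatible_indexing_cap comp (ts_sub TKH) TKH).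
apply: (@ts_eq _ (transfer_of Oa) K _ K) => //; first by rewrite /= setIid.
exact: transfer_rel_refl.
Qed.
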